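(* Let $n = m\lambda$. Then: (i) $M_\lambda(n,2) = \frac{n!}{(\lambda!)^m}$; (ii) $M_\lambda(n,n) = m$; (iii) $M_\lambda(n,d) \geq M_\lambda(n-\lambda,d)$ and $M_\lambda(n,d)\ge M_\lambda(n,d+1)$; (iv) If $n_1 = m\lambda_1$ and $n_2 = m\lambda_2$, then \[ M_{\lambda_1+\lambda_2}(n_1+n_2, d_1+d_2) \geq \min\{M_{\lambda_1}(n_1,d_1), M_{\lambda_2}(n_2,d_2)\}. \] In particular, $M_{2\lambda}(2n,2d) \geq M_\lambda(n,d)$. (v) $M_\lambda(n,d) \leq \frac{M(n,d)}{\lambda}$ and $M_\lambda(n,d) \leq \frac{n!}{\lambda (d-1)!}$. Moreover, for any divisor $l$ of $\lambda$, $M_\lambda(n,d) \leq \frac{l}{\lambda} M_l(n,d)$.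
   Context: For $n=m\lambda$ (with $n,m,\lambda$ positive integers), a $\lambda$-permutation of length $n$ is an arrangement (sequence of length $n$) of the multiset consisting of $m$ distinct symbols, each repeated exactly $\lambda$ times. The distance between two distinct $\lambda$-permutations is the Hamming distance, i.e. the number of positions in which they disagree. A frequency permutation array of length $n=m\lambda$, frequency $\lambda$ and minimum distance $d$, denoted $FPA_\lambda(n,d)$, is a set $T$ of $\lambda$-permutations of length $n$ (on the same $m$ symbols) such that the distance between any two members of $T$ is at least $d$; equivalently, it is an $s\times n$ array whose $s$ rows consist of $m$ distinct symbols, each repeated exactly $\lambda$ times, such that the distance between any two rows is at least $d$. $M_\lambda(n,d)$ denotes the maximum possible number of rows in any $FPA_\lambda(n,d)$. When $\lambda=1$, an $FPA_1(n,d)$ is called a permutation array $PA(n,d)$ (a set of permutations of $n$ symbols with pairwise distance at least $d$), and $M(n,d)=M_1(n,d)$ is the maximum possible size of a $PA(n,d)$.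
   Formalization: Part (v) is stated for 1 ≤ d ≤ n only; for d > n it fails (e.g. m = 1, λ = 2, n = 2, d = 3 gives M_2(2,3) = M(2,3) = 1, and 1 ≤ 1/2 is false), and for d = 0 the factorial (d−1)! is undefined. *)

(* Defs.v *)
From mathcomp Require Import all_boot all_order all_algebra.

Set Implicit Arguments.
Unset Strict Implicit.
Unset Printing Implicit Defensive.

Definition hamming (n : nat) (A : eqType) (u v : n.-tuple A) : nat :=
  #|[set i : 'I_n | tnth u i != tnth v i]|.

Definition is_freq_perm (lambda n : nat) (A : finType) (w : n.-tuple A) : bool :=
  [forall a : A, count_mem a w == lambda].

Definition is_FPA (lambda n d : nat) (A : finType) (T : {set n.-tuple A}) : bool :=
  [forall u in T, is_freq_perm lambda u] &&
  [forall u in T, forall v in T, (u != v) ==> (d <= hamming u v)].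

(* M_lambda(n, d). The symbols are the elements of 'I_m with m = n %/ lambda;
   no lambda-permutation of length n exists when lambda does not divide n.
   set0 is always an FPA, so the maximum is over a nonempty family. *)
Definition maxFPA (lambda n d : nat) : nat :=
  \max_(T : {set n.-tuple 'I_(n %/ lambda)} | is_FPA lambda d T) #|T|.

(* M(n, d): a permutation array is an FPA of frequency 1. *)
Definition maxPA (n d : nat) : nat := maxFPA 1 n d.

(* Main.v *)
(** Parts (i), (iii) and (iv) are a multinomial count, the padding of every word
    by one new symbol, and the concatenation of words. For (v), write
    [lambda = k * l] and split every symbol [a] into [k] symbols [(a, c)], [c] in
    Z/k, each used [l] times; adding a constant of Z/k to all second components
    turns each word into [k] words that pairwise disagree everywhere. The bound
    by [n! / (d - 1)!] for permutation arrays holds because words at distance at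
    least [d] are determined by their first [n - d + 1] entries; the same remark
    with [d = n], together with (v) applied to a single constant word, gives
    (ii). *)
Require Import Defs.
From mathcomp Require Import all_boot all_order all_algebra.

Set Implicit Arguments.
Unset Strict Implicit.
Unset Printing Implicit Defensive.

(** * Hamming distance under concatenation and change of symbols *)

Section Hamming.

Variables A B : eqType.

Lemma hammingE n (u v : n.-tuple A) : hamming u v = \sum_(i < n) (tnth u i != tnth v i).
Proof.
rewrite /hamming -sum1_card big_mkcond /=.
by apply: eq_bigr => i _; rewrite inE; case: (_ != _).
Qed.

Lemma hamming_max n (u v : n.-tuple A) : (forall i, tnth u i != tnth v i) -> hamming u v = n.
Proof.
move=> neq_uv; rewrite hammingE (eq_bigr (fun=> 1)) => [|i _].
  by rewrite sum1_card card_ord.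
by rewrite neq_uv.
Qed.

Lemma hamming_cat n m (u v : n.-tuple A) (u' v' : m.-tuple A) :
  hamming [tuple of u ++ u'] [tuple of v ++ v'] = hamming u v + hamming u' v'.
Proof.
rewrite !hammingE big_split_ord /=.
by congr addn; apply: eq_bigr => i _; rewrite ?tnth_lshift ?tnth_rshift.
Qed.

Lemma hamming_map n (f : A -> B) (u v : n.-tuple A) :
  hamming (map_tuple f u) (map_tuple f v) <= hamming u v.
Proof.
apply/subset_leq_card/subsetP => i; rewrite !inE !tnth_map.
by apply: contraNneq => ->.
Qed.

Lemma hamming_map_inj n (f : A -> B) (u v : n.-tuple A) :
  injective f -> hamming (map_tuple f u) (map_tuple f v) = hamming u v.
Proof.
by move=> f_inj; apply: eq_card => i; rewrite !inE !tnth_map (inj_eq f_inj).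
Qed.

End Hamming.

Lemma eq_hamming_small e d (A : eqType) (u v : (e + d).-tuple A) :
  (forall j : 'I_e, tnth u (lshift d j) = tnth v (lshift d j)) ->
  hamming u v <= d.
Proof.
move=> eq_uv; rewrite hammingE big_split_ord /= big1 => [|j _].
  rewrite add0n -[leqRHS]card_ord -sum1_card.
  by apply: leq_sum => j _; apply: leq_b1.
by rewrite eq_uv eqxx.
Qed.

(** * Words of constant frequency *)

Section FreqPerm.

Variables (lambda n : nat) (A : finType).
Implicit Types w : n.-tuple A.

Lemma is_freq_permP w :
  reflect (forall a, count_mem a w = lambda) (is_freq_perm lambda w).
Proof. exact: 'forall_eqP. Qed.

Lemma freq_perm_perm_eq w w' :
  is_freq_perm lambda w -> is_freq_perm lambda w' -> perm_eq w w'.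
Proof.
move=> /is_freq_permP w_freq /is_freq_permP w'_freq.
by apply/allP => a _ /=; rewrite w_freq w'_freq.
Qed.

(** If [i] were the only disagreement, the symbol [tnth w i] would occur once more in [w] than in
    [w'], against the equal frequencies. *)
Lemma hamming_freq_perm_ge2 w w' :
    is_freq_perm lambda w -> is_freq_perm lambda w' -> w != w' ->
  2 <= hamming w w'.
Proof.
move=> /is_freq_permP w_freq /is_freq_permP w'_freq neq_ww'.
rewrite ltnNge; apply: contra neq_ww' => /card_le1_eqP ham1.
apply/eqP/eq_from_tnth => i; apply/eqP; apply/idPn => neq_i.
have eq_off j : j != i -> tnth w j = tnth w' j.
  move=> neq_ji; apply/eqP; apply: contraNT neq_ji => neq_j.
  by apply/eqP/ham1; rewrite inE.
have := w_freq (tnth w i); rewrite -(w'_freq (tnth w i)) -!sum1_count !big_tuple.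
rewrite !(big_mkcond (fun _ => _ == _)) /= !(bigD1 (P := predT) i) //= eqxx.
rewrite [tnth w' i == _]eq_sym (negPf neq_i) add0n.
rewrite (eq_bigr (fun j => if tnth w' j == tnth w i then 1 else 0)) => [|j /eq_off->] //.
by move=> /eqP; rewrite -[eqbRHS]add0n eqn_add2r.
Qed.

End FreqPerm.

Arguments is_freq_permP {lambda n A w}.

Lemma is_freq_perm_map lambda n (A B : finType) (g : A -> B) (w : n.-tuple A) :
  bijective g -> is_freq_perm lambda w -> is_freq_perm lambda (map_tuple g w).
Proof.
move=> g_bij /is_freq_permP w_freq; have [g' gK g'K] := g_bij.
apply/is_freq_permP => b; rewrite count_map -(w_freq (g' b)).
by apply: eq_count => a /=; rewrite -(inj_eq (bij_inj g_bij)) g'K.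
Qed.

Lemma exists_freq_perm lambda n (A : finType) :
  n = #|A| * lambda -> exists w : n.-tuple A, is_freq_perm lambda w.
Proof.
move=> ->.
pose s := flatten [seq nseq lambda a | a <- enum A].
have count_s a : count_mem a s = lambda.
  rewrite count_flatten -map_comp sumnE big_map big_enum /= (bigD1 a) //=.
  rewrite count_nseq /= eqxx mul1n big1 ?addn0 // => b neq_ba.
  by rewrite count_nseq /= (negPf neq_ba).
have size_s : size s == #|A| * lambda.
  rewrite size_flatten /shape -map_comp sumnE big_map big_enum /=.
  by rewrite (eq_bigr (fun=> lambda)) => [|a _]; rewrite ?sum_nat_const ?size_nseq.
by exists (Tuple size_s); apply/is_freq_permP.
Qed.

(** * The multinomial count *)

Section Multinomial.

Variable T : finType.

(** Induction on the length, sorting rearrangements by their first letter [x]. Removing [x] lowers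
    only its own multiplicity, so [x] contributes its multiplicity times the factorial of [n]; over
    the distinct letters these multiplicities add up to [size s]. *)
Lemma size_permutations_count (s : seq T) :
  size (permutations s) * \prod_(x : T) (count_mem x s)`! = (size s)`!.
Proof.
have [n] := ubnPeq (size s); elim: n s => [|n IHn] s /eqP size_s.
  by case: s size_s => // _; rewrite big1.
rewrite (perm_size (permutationsE _)) ?size_s // size_allpairs_dep.
rewrite sumnE big_map big_distrl /=.
have step x : x \in undup s ->
  size (permutations (rem x s)) * \prod_(y : T) (count_mem y s)`!
    = count_mem x s * n`!.
  rewrite mem_undup => s_x.
  have size_r : size (rem x s) == n by rewrite size_rem // size_s.
  rewrite -(IHn _ size_r).
  rewrite mulnCA; congr muln; rewrite (bigD1 x) //= [in RHS](bigD1 x) //= mulnA.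
  rewrite !count_mem_rem eqxx subn1; congr muln.
    by rewrite -has_pred1 has_count in s_x; case: count s_x.
  by apply: eq_bigr => y neq_yx; rewrite count_mem_rem eq_sym (negPf neq_yx) subn0.
rewrite (eq_big_seq _ step) -big_distrl /= factS -size_s; congr (_ * _).
rewrite -[RHS]sum1_size -[in RHS]big_undup_iterop_count /=.
by apply: eq_bigr => x _; rewrite Monoid.iteropE iter_addn_0 mul1n.
Qed.

(** All such words are the rearrangements of a single one, [b], in which every multiplicity is
    [lambda]. *)
Lemma card_freq_perm lambda n :
    n = #|T| * lambda ->
  #|[set w : n.-tuple T | is_freq_perm lambda w]| * lambda`! ^ #|T| = n`!.
Proof.
move=> def_n; have [b b_freq] := exists_freq_perm def_n.
rewrite -[RHS](congr1 factorial (size_tuple b)) -size_permutations_count.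
rewrite (eq_bigr (fun=> lambda`!)) => [|a _]; last first.
  by move/is_freq_permP: b_freq => ->.
rewrite prod_nat_const; congr (_ * _).
rewrite cardE -(size_map val); apply/perm_size/uniq_perm.
- by rewrite (map_inj_uniq val_inj) enum_uniq.
- exact: permutations_uniq.
move=> s; rewrite mem_permutations; apply/mapP/idP.
  by case=> w; rewrite mem_enum inE => /freq_perm_perm_eq-/(_ _ b_freq) ? ->.
move=> eq_sb; have size_s : size s == n by rewrite (perm_size eq_sb) size_tuple.
exists (Tuple size_s) => //; rewrite mem_enum inE; apply/is_freq_permP => a.
by rewrite (permP eq_sb); move/is_freq_permP: b_freq => ->.
Qed.

End Multinomial.

(* A family over an arbitrary alphabet: only the number of symbols matters for
   [maxFPA]. Injectivity is required separately because [d] may be [0]. *)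
Definition FPA_family (lambda n d : nat) (A : finType) (I : Type)
    (f : I -> n.-tuple A) : Prop :=
  [/\ injective f, forall i, is_freq_perm lambda (f i)
    & forall i j, f i != f j -> d <= hamming (f i) (f j)].

(** * Passing between the maximum and families over any alphabet *)

Section Families.

Variables (lambda n d : nat).

Lemma leq_card_maxFPA (A I : finType) (f : I -> n.-tuple A) :
  #|A| = n %/ lambda -> FPA_family lambda d f -> #|I| <= maxFPA lambda n d.
Proof.
move=> card_A [f_inj f_freq f_dist].
pose g (a : A) : 'I_(n %/ lambda) := cast_ord card_A (enum_rank a).
have g_bij : bijective g.
  by apply: bij_comp; [exists (cast_ord (esym card_A)) | apply: enum_rank_bij];
     [apply: cast_ordK | apply: cast_ordKV].
have g_inj := bij_inj g_bij.
have gf_inj : injective (map_tuple g \o f).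
  by move=> i j /(congr1 val) /= /(inj_map g_inj)/val_inj/f_inj.
rewrite -(card_imset _ gf_inj).
apply: (leq_bigmax_cond (F := fun T : {set _} => #|T|)); apply/andP; split.
  by apply/forall_inP => _ /imsetP[i _ ->]; apply: is_freq_perm_map.
apply/forall_inP => _ /imsetP[i _ ->]; apply/forall_inP => _ /imsetP[j _ ->].
apply/implyP => neq_ij; rewrite hamming_map_inj //; apply: f_dist.
by apply: contraNneq neq_ij => /= ->.
Qed.

(** A largest array exists since the empty set is an array. The free size [k] lets two arrays be cut
    down to a common index type, as concatenation needs. *)
Lemma exists_FPA_family (A : finType) k :
    #|A| = n %/ lambda -> k <= maxFPA lambda n d ->
  exists f : 'I_k -> n.-tuple A, FPA_family lambda d f.
Proof.
move=> card_A.
have set0_FPA : is_FPA lambda d (set0 : {set n.-tuple 'I_(n %/ lambda)}).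
  by apply/andP; split; apply/forall_inP => u; rewrite inE.
rewrite /maxFPA (bigmax_eq_arg _ set0_FPA); case: arg_maxnP => // T T_FPA _ le_kT.
have /andP[/forall_inP T_freq /forall_inP T_dist] := T_FPA.
pose h (i : 'I_k) : n.-tuple 'I_(n %/ lambda) := enum_val (widen_ord le_kT i).
have h_T i : h i \in T by apply: enum_valP.
pose g (b : 'I_(n %/ lambda)) : A := enum_val (cast_ord (esym card_A) b).
have g_bij : bijective g.
  by apply: bij_comp; [apply: enum_val_bij | exists (cast_ord card_A)];
     [apply: cast_ordKV | apply: cast_ordK].
have g_inj := bij_inj g_bij.
exists (map_tuple g \o h); split => [i j|i|i j neq_ij].
- move=> /(congr1 val) /= /(inj_map g_inj)/val_inj/enum_val_inj.
  by case=> /ord_inj.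
- exact: is_freq_perm_map (T_freq _ (h_T i)).
rewrite hamming_map_inj //; move/forall_inP: (T_dist _ (h_T i)).
move=> /(_ _ (h_T j)) /implyP; apply.
by apply: contraNneq neq_ij => /= ->.
Qed.

End Families.

(** * Exact value at distance 2, padding and concatenation *)

Lemma maxFPA_anti lambda n d : maxFPA lambda n d.+1 <= maxFPA lambda n d.
Proof.
have card_A := card_ord (n %/ lambda).
have [f [f_inj f_freq f_dist]] :=
  exists_FPA_family card_A (leqnn (maxFPA lambda n d.+1)).
rewrite -[leqLHS]card_ord; apply: (leq_card_maxFPA (f := f)) => //.
split=> // i j; by move/f_dist/ltnW.
Qed.

(** Distinct words of equal frequency are never at distance 1, so the set of all of them is an
    optimal array. *)
Lemma maxFPA_freq_perms m lambda n :
    n = m * lambda -> 0 < lambda ->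
  maxFPA lambda n 2 * lambda`! ^ m = n`!.
Proof.
move=> def_n lambda_gt0.
have card_A : #|'I_m| = n %/ lambda by rewrite card_ord def_n mulnK.
have -> : maxFPA lambda n 2 = #|[set w : n.-tuple 'I_m | is_freq_perm lambda w]|.
  apply/eqP; rewrite eqn_leq; apply/andP; split.
    have [f [f_inj f_freq _]] :=
      exists_FPA_family card_A (leqnn (maxFPA lambda n 2)).
    rewrite -[leqLHS]card_ord -(card_imset _ f_inj) subset_leq_card //.
    by apply/subsetP => _ /imsetP[i _ ->]; rewrite inE.
  rewrite cardsE -card_sig; apply: (leq_card_maxFPA (f := val)) => //.
  split=> [||u v]; [exact: val_inj | exact: valP |].
  exact: hamming_freq_perm_ge2 (valP u) (valP v).
by rewrite -(@card_freq_perm 'I_m lambda n) ?card_ord // def_n card_ord.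
Qed.

Lemma maxFPA_gt0 m lambda d :
  0 < lambda -> 0 < maxFPA lambda (m * lambda) d.
Proof.
move=> lambda_gt0; have card_A : #|'I_m| = (m * lambda) %/ lambda.
  by rewrite card_ord mulnK.
have [|w w_freq] := @exists_freq_perm lambda (m * lambda) 'I_m.
  by rewrite card_ord.
rewrite -[1]card_unit; apply: (leq_card_maxFPA (f := fun=> w)) => //.
by split=> [[] [] | | ? ?] //; rewrite eqxx.
Qed.

Lemma maxFPA_extend m lambda d :
    0 < lambda ->
  maxFPA lambda (m * lambda) d <= maxFPA lambda (m * lambda + lambda) d.
Proof.
move=> lambda_gt0; have card_A : #|'I_m| = (m * lambda) %/ lambda.
  by rewrite card_ord mulnK.
have [f [f_inj f_freq f_dist]] :=
  exists_FPA_family card_A (leqnn (maxFPA lambda (m * lambda) d)).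
rewrite -[leqLHS]card_ord.
(* [None] is the new symbol; the common suffix leaves distances unchanged. *)
pose pad w : (m * lambda + lambda).-tuple (option 'I_m) :=
  [tuple of map_tuple Some w ++ nseq_tuple lambda None].
apply: (leq_card_maxFPA (f := pad \o f)).
  by rewrite card_option card_ord -mulSnr mulnK.
have pad_inj : injective pad.
  move=> u v /(congr1 (take (m * lambda) \o val)) /=.
  rewrite !take_size_cat ?size_map ?size_tuple //.
  by move/(inj_map Some_inj)/val_inj.
split=> [|i|i j]; first exact: inj_comp.
  apply/is_freq_permP => -[a|] /=; rewrite count_cat count_map count_nseq /=.
    by rewrite mul0n addn0 -[RHS](is_freq_permP (f_freq i) a); apply: eq_count.
  by rewrite mul1n (eq_count (a2 := pred0)) // count_pred0.
rewrite (inj_eq pad_inj) => /f_dist le_d; rewrite hamming_cat hamming_map_inj //.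
  exact: leq_trans le_d (leq_addr _ _).
exact: Some_inj.
Qed.

Lemma maxFPA_cat m lambda1 lambda2 d1 d2 :
    0 < lambda1 -> 0 < lambda2 ->
  minn (maxFPA lambda1 (m * lambda1) d1) (maxFPA lambda2 (m * lambda2) d2)
    <= maxFPA (lambda1 + lambda2) (m * lambda1 + m * lambda2) (d1 + d2).
Proof.
move=> lambda1_gt0 lambda2_gt0; set k := minn _ _.
have [||f [f_inj f_freq f_dist]] :=
  @exists_FPA_family lambda1 (m * lambda1) d1 'I_m k; rewrite ?geq_minl //.
  by rewrite card_ord mulnK.
have [||g [g_inj g_freq g_dist]] :=
  @exists_FPA_family lambda2 (m * lambda2) d2 'I_m k; rewrite ?geq_minr //.
  by rewrite card_ord mulnK.
rewrite -[k]card_ord.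
apply: (leq_card_maxFPA (f := fun i => [tuple of f i ++ g i])).
  by rewrite card_ord -mulnDr mulnK // addn_gt0 lambda1_gt0.
split=> [i j|i|i j].
- move/(congr1 (take (m * lambda1) \o val)) => /=.
  by rewrite !take_size_cat ?size_tuple // => /val_inj/f_inj.
- apply/is_freq_permP => a /=; rewrite count_cat.
  by rewrite (is_freq_permP (f_freq i)) (is_freq_permP (g_freq i)).
(* Both families are injective, so distinct indices give distinct words in each half and both
   distance bounds apply. *)
move=> neq_ij; have {neq_ij} neq_ij : i != j by apply: contraNneq neq_ij => ->.
by rewrite hamming_cat leq_add ?f_dist ?g_dist ?inj_eq.
Qed.

(** * Splitting symbols *)

Lemma perm_map_lift (T U : eqType) (h : T -> U) (s : seq U) (t : seq T) :
  perm_eq s (map h t) -> exists2 t', perm_eq t' t & map h t' = s.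
Proof.
case: t => [|x0 t]; first by move/perm_nilP->; exists [::].
(* The indices [ks] that rearrange [map h t] into [s] also rearrange [t], which gives the lift. *)
move: (x0 :: t) => {}t /(perm_iotaP (h x0)) /=; rewrite size_map.
move=> [ks ks_iota ->]; exists (map (nth x0 t) ks).
  by apply/(perm_iotaP x0); exists ks.
rewrite -map_comp; apply/eq_in_map => k; rewrite (perm_mem ks_iota) mem_iota /=.
by move=> lt_kt; rewrite (nth_map x0).
Qed.

Lemma count_map_fst (A : eqType) (B : finType) (s : seq (A * B)) (a : A) :
  count_mem a (map fst s) = \sum_(c : B) count_mem (a, c) s.
Proof.
elim: s => [|[x y] s IHs] /=; first by rewrite big1.
rewrite big_split IHs /=; congr addn; rewrite (bigD1 y) //= xpair_eqE eqxx andbT.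
rewrite big1 ?addn0 // => c neq_cy.
by rewrite xpair_eqE [y == c]eq_sym (negPf neq_cy) andbF.
Qed.

(** Any word [b] of frequency [l] over [A * B] projects to a rearrangement of [w]; undoing that
    rearrangement on [b] gives the lift. *)
Lemma freq_perm_lift l n (A B : finType) (w : n.-tuple A) :
    n = #|A| * (#|B| * l) -> is_freq_perm (#|B| * l) w ->
  exists w' : n.-tuple (A * B), is_freq_perm l w' /\ map_tuple fst w' = w.
Proof.
move=> def_n w_freq; have [|b b_freq] := @exists_freq_perm l n (A * B)%type.
  by rewrite card_prod -mulnA.
have [|t eq_tb map_t] := @perm_map_lift _ _ fst w b.
  apply/allP => a _ /=; rewrite (is_freq_permP w_freq) count_map_fst.
  rewrite (eq_bigr (fun=> l)) ?sum_nat_const // => c _.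
  exact: (is_freq_permP b_freq).
have size_t : size t == n by rewrite (perm_size eq_tb) size_tuple.
exists (Tuple size_t); split; last exact: val_inj.
by apply/is_freq_permP => p; rewrite (permP eq_tb) (is_freq_permP b_freq).
Qed.

(** The factor is written [k.+1] so that ['I_k.+1] carries the addition of a cyclic group. Shifted
    copies of one word are at distance exactly [n], hence [d <= n]; [0 < d] turns the distance bound
    into injectivity. *)
Lemma maxFPA_split m l k d (n := m * (k.+1 * l)) :
    0 < l -> 0 < d <= n ->
  k.+1 * maxFPA (k.+1 * l) n d <= maxFPA l n d.
Proof.
move=> l_gt0 /andP[d_gt0 le_dn].
have card_A : #|'I_m| = n %/ (k.+1 * l) by rewrite card_ord mulnK // muln_gt0.
have [f [f_inj f_freq f_dist]] :=
  exists_FPA_family card_A (leqnn (maxFPA (k.+1 * l) n d)).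
have lift_f i : exists w' : n.-tuple ('I_m * 'I_k.+1),
    is_freq_perm l w' /\ map_tuple fst w' = f i.
  by apply: freq_perm_lift; rewrite !card_ord.
have [g g_lift] := fin_all_exists lift_f.
pose sh (s : 'I_k.+1) (p : 'I_m * 'I_k.+1) := (p.1, (p.2 + s)%R).
have sh_inj s : injective (sh s).
  move=> [x y] [x' y'] /eqP; rewrite xpair_eqE (inj_eq (@GRing.addIr _ s)) /=.
  by case/andP=> /eqP-> /eqP->.
pose F i := map_tuple (sh i.2) (g i.1).
have fst_F i : map_tuple fst (F i) = f i.1.
  rewrite -(g_lift i.1).2; apply: val_inj; rewrite /= -map_comp.
  exact: eq_map.
have dist_F i j : i != j -> d <= hamming (F i) (F j).
  (* With the same base word the shifts differ, so all positions disagree. With different base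
     words, first components give back [f], and mapping symbols cannot increase the distance. *)
  case: (eqVneq i.1 j.1) => [eq1 neq_ij|neq1 _].
    rewrite hamming_max // => p; rewrite !tnth_map eq1 /sh xpair_eqE eqxx /=.
    by rewrite (inj_eq (GRing.addrI _)); apply: contraNneq neq_ij => eq2;
       rewrite [i]surjective_pairing eq1 eq2 -surjective_pairing.
  apply: leq_trans (hamming_map fst _ _); rewrite !fst_F.
  by apply: f_dist; rewrite (inj_eq f_inj).
rewrite -{1}[k.+1]card_ord -[maxFPA _ _ _ in leqLHS]card_ord mulnC -card_prod.
apply: (leq_card_maxFPA (f := F)).
  by rewrite card_prod !card_ord /n mulnA mulnK.
split=> [i j eq_F|i|i j neq_F].
- apply/eqP; apply: contraLR d_gt0 => /dist_F; rewrite eq_F -leqNgt.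
  by rewrite hammingE big1 // => p _; rewrite eqxx.
- exact: is_freq_perm_map (injF_bij (sh_inj _)) (g_lift i.1).1.
by apply: dist_F; apply: contraNneq neq_F => ->.
Qed.

(** * Upper bounds by counting prefixes *)

Lemma FPA_family_prefix_inj lambda e d (A : finType) I
    (f : I -> (e + d).-tuple A) :
  FPA_family lambda d.+1 f ->
  injective (fun i => [tuple tnth (f i) (lshift d j) | j < e]).
Proof.
move=> [f_inj _ f_dist] i j /= eq_ij; apply/f_inj/eqP.
apply: contraT => /f_dist; rewrite ltnNge eq_hamming_small // => k.
by have := congr1 (fun t => tnth t k) eq_ij; rewrite !tnth_mktuple.
Qed.

Lemma maxFPA_singleton lambda e d :
  maxFPA lambda (e + d) d.+1 <= ((e + d) %/ lambda) ^ e.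
Proof.
have card_A := card_ord ((e + d) %/ lambda).
have [f f_fam] := exists_FPA_family card_A (leqnn (maxFPA lambda (e + d) d.+1)).
rewrite -[leqLHS]card_ord -[X in X ^ e]card_A -card_tuple.
exact: leq_card (FPA_family_prefix_inj f_fam).
Qed.

(** At frequency 1 no entry repeats, so the determining prefixes are duplicate-free [e]-tuples,
    counted by the falling factorial. *)
Lemma maxPA_singleton e d : maxPA (e + d) d.+1 <= (e + d) ^_ e.
Proof.
have card_A : #|'I_(e + d)| = (e + d) %/ 1 by rewrite card_ord divn1.
have [f f_fam] := exists_FPA_family card_A (leqnn (maxPA (e + d) d.+1)).
pose F i := [tuple tnth (f i) (lshift d j) | j < e].
rewrite -[leqLHS]card_ord -[X in X ^_ e]card_ord.
rewrite -(card_uniq_tuples e predT) -(card_imset _ (FPA_family_prefix_inj f_fam)).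
apply/subset_leq_card/subsetP => _ /imsetP[i _ ->]; rewrite inE all_predT /=.
rewrite map_inj_uniq ?enum_uniq // => j j'.
have /tuple_uniqP f_uniq : uniq (f i).
  have [_ f_freq _] := f_fam; apply: count_mem_uniq => a.
  by rewrite -has_pred1 has_count (is_freq_permP (f_freq i)).
by move/f_uniq/lshift_inj.
Qed.

Lemma maxFPA_full m lambda (n := m * lambda) :
  0 < m -> 0 < lambda -> maxFPA lambda n n = m.
Proof.
move=> m_gt0 lambda_gt0; have n_gt0 : 0 < n by rewrite muln_gt0 m_gt0.
apply/eqP; rewrite eqn_leq; apply/andP; split.
  (* At distance [n] a prefix of length 1 determines the word. *)
  have := maxFPA_singleton lambda 1 n.-1.
  by rewrite add1n prednK // expn1 mulnK.
case: m @n m_gt0 n_gt0 => // k n _ n_gt0.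
(* Over one symbol the constant word has frequency [k.+1 * lambda]; splitting that symbol yields
   [k.+1] words. *)
have := @maxFPA_split 1 lambda k n lambda_gt0; rewrite mul1n n_gt0 leqnn => /(_ isT).
apply: leq_trans; rewrite leq_pmulr //.
by rewrite -[n in maxFPA _ n]mul1n maxFPA_gt0.
Qed.

(** * Assembling the five statements, with quotients in [rat] *)

Import Order.TTheory GRing.Theory Num.Theory.

Theorem theorem2p5 (m lambda n : nat)
    (hm : 0 < m) (hlambda : 0 < lambda) (hn : n = m * lambda) :
  [/\ (* (i) *)
      ((maxFPA lambda n 2)%:R = (n`!)%:R / ((lambda`!)%:R ^+ m) :> rat)%R,
      (* (ii) *)
      maxFPA lambda n n = m,
      (* (iii) *)
      (forall d : nat,
         maxFPA lambda (n - lambda) d <= maxFPA lambda n d /\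
         maxFPA lambda n d.+1 <= maxFPA lambda n d),
      (* (iv) *)
      (forall lambda1 lambda2 n1 n2 d1 d2 : nat,
         0 < lambda1 -> 0 < lambda2 ->
         n1 = m * lambda1 -> n2 = m * lambda2 ->
         minn (maxFPA lambda1 n1 d1) (maxFPA lambda2 n2 d2)
           <= maxFPA (lambda1 + lambda2) (n1 + n2) (d1 + d2)) /\
      (forall d : nat,
         maxFPA lambda n d <= maxFPA (2 * lambda) (2 * n) (2 * d))
    & (* (v) *)
      forall d : nat, 0 < d <= n ->
        [/\ ((maxFPA lambda n d)%:R <= (maxPA n d)%:R / lambda%:R :> rat)%R,
            ((maxFPA lambda n d)%:R
               <= (n`!)%:R / (lambda%:R * ((d - 1)`!)%:R) :> rat)%R
          & forall l : nat, l %| lambda ->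
              ((maxFPA lambda n d)%:R
                 <= l%:R / lambda%:R * (maxFPA l n d)%:R :> rat)%R]].

Proof.
have split_n l d : l %| lambda -> 0 < d <= n ->
    ((maxFPA lambda n d)%:R <= l%:R / lambda%:R * (maxFPA l n d)%:R :> rat)%R.
  move=> /dvdnP[k def_lambda] dn; subst lambda n.
  move: hlambda dn; rewrite muln_gt0 => /andP[]; case: k => // k _ l_gt0 dn.
  rewrite natrM invfM [(_^-1 * _)%R]mulrC mulrA divff ?pnatr_eq0 -?lt0n // mul1r.
  rewrite mulrC ler_pdivlMr ?ltr0n // -natrM ler_nat mulnC.
  exact: maxFPA_split.
split.
- rewrite -(maxFPA_freq_perms hn hlambda) natrM natrX mulfK //.
  by rewrite expf_neq0 // pnatr_eq0 -lt0n fact_gt0.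
- by rewrite hn maxFPA_full.
- move=> d; split; last exact: maxFPA_anti.
  (* The shortened length is [m' * lambda]: one symbol fewer, possibly none. *)
  case: m hm hn => // m' _ ->.
  by rewrite mulSnr addnK maxFPA_extend.
- split=> [lambda1 lambda2 n1 n2 d1 d2 lambda1_gt0 lambda2_gt0 -> ->|d].
    exact: maxFPA_cat.
  rewrite !mul2n -!addnn hn; apply: leq_trans (maxFPA_cat _ _ _ _ _) => //.
  by rewrite minnn.
move=> d dn.
have le_PA : ((maxFPA lambda n d)%:R <= (maxPA n d)%:R / lambda%:R :> rat)%R.
  by rewrite mulrC -[(_^-1)%R]mul1r; apply: (split_n 1).
split=> // [|l l_dvd]; last exact: split_n.
apply: (le_trans le_PA); rewrite invfM mulrCA [X in (X <= _)%R]mulrC.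
rewrite ler_wpM2l ?invr_ge0 ?ler0n //.
rewrite ler_pdivlMr ?ltr0n ?fact_gt0 // -natrM ler_nat.
case/andP: dn => d_gt0 le_dn; have lt_dn : d - 1 <= n by apply: leq_trans le_dn; apply: leq_subr.
(* The determining prefix has [n - (d - 1)] entries; [0 < d] turns [(d - 1).+1] back into [d]. *)
have := maxPA_singleton (n - (d - 1)) (d - 1); rewrite subnK // -addn1 subnK //.
move=> le_ff; apply: leq_trans (leq_mul le_ff (leqnn _)) _.
by rewrite -{2}(subKn lt_dn) ffact_fact ?leq_subr.
Qed.
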